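(* Let $X:g=0$ be a reduced affine hypersurface in $\mathbb{C}^n$. Then $X$ is $A$-free if and only if it is $A_0$-free, if one of the following cases occurs. (1) The polynomial function $g:\mathbb{C}^n\to\mathbb{C}$ has no singularities, i.e. it is a submersion; equivalently, $J_g=R$. (2) The polynomial $g$ is weighted homogeneous of type $(w_1,\ldots,w_n;N)$, where the weights $w_j$ are positive or negative integers, and the weighted degree $N$ is not zero.
   Context: $R=\mathbb{C}[x_1,\ldots,x_n]$, $\partial_j=\partial/\partial x_j$, $g\in R$ is a nonconstant reduced (square-free) polynomial, and $J_g=(\partial_1g,\ldots,\partial_ng)\subset R$ is its Jacobian ideal. $Der(R)=\{\alpha_1\partial_1+\cdots+\alpha_n\partial_n : \alpha_j\in R\}$; $Der(X)=\{\partial\in Der(R):\partial g\in (g)\}$ and $Der_0(X)=\{\partial\in Der(R):\partial g=0\}$. The hypersurface $X$ is called $A$-free (resp. $A_0$-free) if the $R$-module $Der(X)$ (resp. $Der_0(X)$) is free. A polynomial is weighted homogeneous of type $(w_1,\ldots,w_n;N)$ if every monomial $x_1^{a_1}\cdots x_n^{a_n}$ occurring in it with nonzero coefficient satisfies $w_1a_1+\cdots+w_na_n=N$. *)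

(* Defs.v *)
From mathcomp Require Import all_boot all_order all_algebra.
From mathcomp Require Import boolp classical_sets reals.
From mathcomp Require Import complex mpoly.

Set Implicit Arguments.
Unset Strict Implicit.
Unset Printing Implicit Defensive.

Import Order.TTheory GRing.Theory Num.Theory.
Local Open Scope classical_set_scope.
Local Open Scope ring_scope.

(* Bases are sets of vectors of any cardinality, linear combinations being finite. *)
Section FreeModules.
Variables (A : comNzRingType) (V : lmodType A).

Definition lin_span (B : set V) : set V :=
  [set v | exists (s : seq V) (a : V -> A),
     (forall u, u \in s -> B u) /\ v = \sum_(u <- s) a u *: u].

Definition lin_independent (B : set V) : Prop :=
  forall (s : seq V) (a : V -> A), uniq s -> (forall u, u \in s -> B u) ->
    \sum_(u <- s) a u *: u = 0 -> forall u, u \in s -> a u = 0.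

(* [M = lin_span B] forces [M] to be a submodule of [V] containing [B]. *)
Definition is_free_module (M : set V) : Prop :=
  exists B : set V, lin_independent B /\ M = lin_span B.

End FreeModules.

Section Hypersurfaces.
Variables (R : realType) (n : nat).
Implicit Types (g p : {mpoly R[i][n]}).

(* The derivation alpha_1 d_1 + ... + alpha_n d_n is encoded by the row of its
   coefficients, so that Der(C[x_1, ..., x_n]) is 'rV_n as a module. *)
Definition der := 'rV[{mpoly R[i][n]}]_n.

Definition der_apply (d : der) p : {mpoly R[i][n]} :=
  \sum_(j < n) d 0 j * p^`M(j).

Definition principal_ideal g : set {mpoly R[i][n]} :=
  [set p | exists q, p = q * g].

Definition jacobian_ideal g : set {mpoly R[i][n]} :=
  [set p | exists a : 'I_n -> {mpoly R[i][n]}, p = \sum_(j < n) a j * g^`M(j)].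

Definition Der g : set der := [set d | principal_ideal g (der_apply d g)].

Definition Der0 g : set der := [set d | der_apply d g = 0].

Definition A_free g : Prop := is_free_module (Der g).

Definition A0_free g : Prop := is_free_module (Der0 g).

Definition nonconstant g : Prop := forall c : R[i], g <> c%:MP.

Definition reduced g : Prop :=
  forall p, principal_ideal (p ^+ 2) g -> p \is a GRing.unit.

Definition singular_point g (x : 'I_n -> R[i]) : Prop :=
  forall j, (g^`M(j)).@[x] = 0.

Definition differential g (x v : 'I_n -> R[i]) : R[i] :=
  \sum_(j < n) (g^`M(j)).@[x] * v j.

Definition submersion g : Prop :=
  forall (x : 'I_n -> R[i]) (c : R[i]), exists v, differential g x v = c.

Definition weighted_homogeneous (w : 'I_n -> int) (N : int) g : Prop :=
  forall m : 'X_{1..n}, g@_m != 0 -> \sum_(j < n) w j * (m j)%:Z = N.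

End Hypersurfaces.

(* Main.v *)
Require Import Defs.
From HB Require Import structures.
From mathcomp Require Import all_boot all_order all_algebra.
From mathcomp Require Import boolp classical_sets reals.
From mathcomp Require Import perm complex mpoly ring.

(* Both cases provide a derivation theta with theta g = g: in case (1) write
   1 = sum a_j d_j g and multiply by g, in case (2) take the Euler field divided
   by N.  Hence Der(X) is the direct sum of Der_0(X) and the free module on
   theta, and one implication is immediate.  Conversely, if Der(X) has basis
   b_1, ..., b_r with b_i g = q_i g, then the row (q_i) is unimodular because
   theta is a combination of the b_i; by the Quillen-Suslin theorem it can be
   moved to (1, 0, ..., 0) by an invertible matrix, and the last r - 1 vectors of
   the new basis form a basis of Der_0(X).

   The Quillen-Suslin theorem is obtained by Suslin's elementary argument: after
   a linear change of variables an entry is monic in the last variable x; if c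
   lies in the ideal generated by two entries and is free of x, then v(b) and
   v(b + c t) are equivalent for all b and t.  These c form an ideal without
   zeros, so v(x) is equivalent to v(0) by the weak Nullstellensatz. *)

Set Implicit Arguments.
Unset Strict Implicit.
Unset Printing Implicit Defensive.

Import Order.TTheory GRing.Theory Num.Theory.
Local Open Scope classical_set_scope.
Local Open Scope ring_scope.

(** * Equivalence of rows, elimination of a variable *)

Section RowEquivalence.
Variable A : comNzRingType.

Definition row_equiv r (v w : 'rV[A]_r) :=
  exists M N : 'M[A]_r, [/\ M *m N = 1%:M, N *m M = 1%:M & v *m M = w].

Definition unimodular r (v : 'rV[A]_r) := exists u : 'cV[A]_r, v *m u = 1%:M.

Lemma row_equiv_refl r (v : 'rV[A]_r) : row_equiv v v.
Proof. by exists 1%:M, 1%:M; rewrite !mulmx1. Qed.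

Lemma row_equiv_sym r (v w : 'rV[A]_r) : row_equiv v w -> row_equiv w v.
Proof.
move=> [M [N [MN NM <-]]]; exists N, M; split=> //.
by rewrite -mulmxA MN mulmx1.
Qed.

Lemma row_equiv_trans r (v u w : 'rV[A]_r) :
  row_equiv v u -> row_equiv u w -> row_equiv v w.
Proof.
move=> [M [N [MN NM <-]]] [M' [N' [MN' NM' <-]]].
exists (M *m M'), (N' *m N); split; last by rewrite mulmxA.
  by rewrite mulmxA -(mulmxA M) MN' mulmx1.
by rewrite mulmxA -(mulmxA N') NM mulmx1.
Qed.

Lemma row_equiv_mul r (v : 'rV[A]_r) (M N : 'M[A]_r) :
  M *m N = 1%:M -> N *m M = 1%:M -> row_equiv v (v *m M).
Proof. by move=> MN NM; exists M, N. Qed.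

Lemma unimodular_equiv r (v w : 'rV[A]_r) :
  row_equiv v w -> unimodular v -> unimodular w.
Proof.
move=> [M [N [MN NM <-]]] [u vu]; exists (N *m u).
by rewrite mulmxA -(mulmxA v) MN mulmx1.
Qed.

(** The row is the first row of an upper triangular matrix with diagonal [(v 0 0, 1, ..., 1)], which
    is invertible because [v 0 0] is a unit. *)
Lemma row_equiv_unit s (v : 'rV[A]_(1 + s)) a :
  a * v 0 0 = 1 -> row_equiv v (delta_mx 0 0).
Proof.
move=> av; apply: row_equiv_sym.
have -> : v = row_mx (v 0 0)%:M (rsubmx v).
  rewrite -{1}(hsubmxK v); congr row_mx; rewrite [lsubmx v]mx11_scalar !mxE.
  by congr (v _ _)%:M; apply: val_inj.
set x := v 0 0 in av *; set w := rsubmx v.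
have -> : delta_mx 0 0 = row_mx 1%:M 0 :> 'rV[A]_(1 + s).
  apply/rowP=> j; rewrite !mxE; case: splitP => i /= ji.
    by rewrite !mxE !ord1 /= -val_eqE /= ji !ord1.
  by rewrite !mxE -val_eqE /= ji.
exists (block_mx x%:M w 0 1%:M), (block_mx a%:M (- (a *: w)) 0 1%:M); split.
- rewrite mulmx_block !(mulmx0, mul0mx, mulmx1, mul1mx, addr0, add0r).
  rewrite -scalar_mxM mulrC av mul_scalar_mx scalerN scalerA mulrC av scale1r.
  by rewrite addNr -scalar_mx_block.
- rewrite mulmx_block !(mulmx0, mul0mx, mulmx1, mul1mx, addr0, add0r).
  by rewrite -scalar_mxM av mul_scalar_mx subrr -scalar_mx_block.
- by rewrite mul_row_block !mul1mx !mul0mx !addr0.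
Qed.

Lemma row_equiv_xcol r (i : 'I_r.+1) (v : 'rV[A]_r.+1) :
  row_equiv v (xcol 0 i v).
Proof.
rewrite xcolE; apply: row_equiv_mul (tperm_mx 0 i) _ _;
  by rewrite -perm_mxM tperm2 perm_mx1.
Qed.

Lemma row_equiv_transvection r s (v : 'rV[A]_r) (w : 'rV[A]_s) (X : 'M[A]_(r, s)) :
  row_equiv (row_mx v w) (row_mx v (w + v *m X)).
Proof.
exists (block_mx 1%:M X 0 1%:M), (block_mx 1%:M (- X) 0 1%:M); split.
- by rewrite mulmx_block !(mulmx0, mul0mx, mulmx1, mul1mx, addr0, add0r) addNr
    -scalar_mx_block.
- by rewrite mulmx_block !(mulmx0, mul0mx, mulmx1, mul1mx, addr0, add0r) subrr
    -scalar_mx_block.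
- by rewrite mul_row_block !mulmx0 !mulmx1 !addr0 addrC.
Qed.

Lemma row_equiv_row_mx r s (v v' : 'rV[A]_r) (w : 'rV[A]_s) :
  row_equiv v v' -> row_equiv (row_mx v w) (row_mx v' w).
Proof.
move=> [M [N [MN NM <-]]].
exists (block_mx M 0 0 1%:M), (block_mx N 0 0 1%:M); split.
- by rewrite mulmx_block !(mulmx0, mul0mx, mulmx1, addr0, add0r) MN -scalar_mx_block.
- by rewrite mulmx_block !(mulmx0, mul0mx, mulmx1, addr0, add0r) NM -scalar_mx_block.
- by rewrite mul_row_block !mulmx0 !mulmx1 !addr0 !add0r.
Qed.

Lemma row_equiv_row_mx_r r s (v : 'rV[A]_r) (w w' : 'rV[A]_s) :
  row_equiv w w' -> row_equiv (row_mx v w) (row_mx v w').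
Proof.
move=> [M [N [MN NM <-]]].
exists (block_mx 1%:M 0 0 M), (block_mx 1%:M 0 0 N); split.
- by rewrite mulmx_block !(mulmx0, mul0mx, mulmx1, addr0, add0r) MN -scalar_mx_block.
- by rewrite mulmx_block !(mulmx0, mul0mx, mulmx1, addr0, add0r) NM -scalar_mx_block.
- by rewrite mul_row_block !mulmx0 !mulmx1 !addr0 !add0r.
Qed.

End RowEquivalence.

Lemma row_equiv_map (A B : comNzRingType) (f : {rmorphism A -> B}) r
    (v w : 'rV[A]_r) :
  row_equiv v w -> row_equiv (map_mx f v) (map_mx f w).
Proof.
move=> [M [N [MN NM <-]]]; exists (map_mx f M), (map_mx f N).
by rewrite -!map_mxM MN NM !map_mx1.
Qed.

Lemma unimodular_map (A B : comNzRingType) (f : {rmorphism A -> B}) r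
    (v : 'rV[A]_r) :
  unimodular v -> unimodular (map_mx f v).
Proof. by move=> [u vu]; exists (map_mx f u); rewrite -map_mxM vu map_mx1. Qed.

Section Elimination.
Variables (A : comNzRingType) (k : closedFieldType).

(** Monic polynomials keep their sizes under [f], so the two Sylvester matrices have the same shape
    and correspond entrywise. *)
Lemma resultant_map (f : {rmorphism A -> k}) (p q : {poly A}) :
  p \is monic -> q \is monic ->
  f (resultant p q) = resultant (map_poly f p) (map_poly f q).
Proof.
move=> /monicP mp /monicP mq.
have sz_map h : lead_coef h = 1 -> size (map_poly f h) = size h.
  by move=> lch; rewrite size_map_poly_id0 // lch rmorph1 oner_eq0.
rewrite /resultant /Sylvester_mx !sz_map // -det_map_mx /= map_col_mx.
by congr (\det (col_mx _ _)); apply: map_lin1_mx => v;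
  rewrite map_poly_rV rmorphM /= map_rVpoly.
Qed.

(* Adding a large multiple of [p] makes [q] monic without changing the ideal
   (p, q), so that the resultant commutes with specialization. *)
Lemma elimination (f : {rmorphism A -> k}) (p q : {poly A}) :
  p \is monic -> (forall x, root (map_poly f p) x -> ~~ root (map_poly f q) x) ->
  exists c u v, c%:P = u * p + v * q /\ f c != 0.
Proof.
move=> mp pq.
(* [resultant_in_ideal] asks for sizes above 1; a monic constant is 1, and then [c = 1] will do. *)
have [sp|sp] := leqP (size p) 1.
  have p1 : p = 1.
    by move/monicP: mp; rewrite (size1_polyC sp) lead_coefC => ->.
  exists 1, 1, 0; rewrite p1 mul0r addr0 mulr1.
  by split=> //; rewrite rmorph1 oner_neq0.
pose q' := p * 'X^(size q) + q.
have sq : (size q < size (p * 'X^(size q))%R)%N.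
  rewrite size_monicM ?monic_neq0 ?monicXn // size_polyXn addnS /=.
  by rewrite -[X in (X < _)%N]add0n ltn_add2r ltnW.
have mq' : q' \is monic by rewrite monicE lead_coefDl // -monicE monicMr ?monicXn.
have sq' : (1 < size q')%N.
  rewrite size_polyDl //; apply: leq_trans (_ : size p <= _)%N => //.
  by rewrite size_monicM ?monic_neq0 ?monicXn // size_polyXn addnS leq_addr.
have [[u v] _ /= res] := resultant_in_ideal sp sq'.
exists (resultant p q'), (u + v * 'X^(size q)), v; split.
  by rewrite res /q' mulrDr mulrDl -addrA -mulrA [p * 'X^_]mulrC.
(* If the specialized resultant vanished, [p] and [q'] would acquire a common root, and [q'] agrees
   with [q] at the roots of [p]. *)
rewrite resultant_map // resultant_eq0 -leqNgt.
case: leqP => // sg.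
have /closed_rootP[x] : size (gcdp (map_poly f p) (map_poly f q')) != 1%N.
  by rewrite neq_ltn sg orbT.
rewrite root_gcd => /andP[px]; move: (pq x px).
by rewrite /q' rmorphD rmorphM /= /root hornerD hornerM (eqP px) mul0r add0r => /negPf->.
Qed.

(** For each [x] in [rs] the sum evaluated at [x] is a nonzero polynomial in [t]; the product of
    these finitely many polynomials has a nonroot. *)
Lemma common_nonroot s (w : 'I_s -> {poly k}) (rs : seq k) :
  (forall x, x \in rs -> exists i, ~~ root (w i) x) ->
  exists t, forall x, x \in rs -> ~~ root (\sum_(i < s) t ^+ i *: w i) x.
Proof.
move=> hw.
pose c x i := if insub i is Some j then (w j).[x] else 0.
have cE x (i : 'I_s) : c x i = (w i).[x].
  by rewrite /c insubT //= => lt_i; congr (w _).[_]; apply: val_inj.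
pose q x : {poly k} := \poly_(i < s) c x i.
have qE x t : (q x).[t] = (\sum_(i < s) t ^+ i *: w i).[x].
  rewrite horner_poly horner_sum; apply: eq_bigr => i _.
  by rewrite hornerZ mulrC cE.
have /closed_nonrootP[t ht] : \prod_(x <- rs) q x != 0.
  rewrite prodf_seq_neq0; apply/allP=> x /hw[i wi] /=.
  apply: contraNneq wi => qx0; have := coef_poly s (c x) i.
  by rewrite -/(q x) qx0 coef0 ltn_ord cE /root => <-.
exists t => x xrs; apply: contra ht; rewrite /root -qE => /eqP qxt.
rewrite horner_prod prodf_seq_eq0; apply/hasP; exists x => //=; exact/eqP.
Qed.

End Elimination.

(** * Suslin's lemma *)

Lemma scalemxI (A : idomainType) r s (c : A) :
  c != 0 -> injective (fun M : 'M[A]_(r, s) => c *: M).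
Proof.
move=> c0 M N /matrixP MN; apply/matrixP=> i j; apply: (mulfI c0).
by have := MN i j; rewrite !mxE.
Qed.


Section Suslin.
Variable A : idomainType.
Implicit Types (b t p : {poly A}).

Definition subst_row b r (v : 'rV[{poly A}]_r) := map_mx (comp_poly b) v.

Lemma comp_poly_shift p b t : exists d, p \Po (b + t) = p \Po b + t * d.
Proof.
elim/poly_ind: p => [|p c [d IH]]; first by exists 0; rewrite !comp_poly0 mulr0 addr0.
exists (p \Po b + d * (b + t)).
rewrite !comp_poly_MXaddC IH; ring.
Qed.

Lemma comp_mx_shift r s (M : 'M[{poly A}]_(r, s)) b t :
  exists D, map_mx (comp_poly (b + t)) M = map_mx (comp_poly b) M + t *: D.
Proof.
have /fin_all_exists[D MD] : forall ij : 'I_r * 'I_s, exists d,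
    M ij.1 ij.2 \Po (b + t) = (M ij.1 ij.2 \Po b) + t * d.
  by move=> ij; apply: comp_poly_shift.
exists (\matrix_(i, j) D (i, j)); apply/matrixP=> i j; rewrite !mxE.
exact: (MD (i, j)).
Qed.

(* [M b *m M' (b + c t)] is congruent to [c%:M] modulo [c]; dividing it by [c]
   gives the change of basis from [u b] to [u (b + c t)]. *)
Lemma suslin_pair r (u : 'rV[{poly A}]_r) (M M' : 'M[{poly A}]_r)
    (e : 'rV[A]_r) (c : A) b t :
    c != 0 -> M *m M' = c%:P%:M -> M' *m M = c%:P%:M ->
    u *m M = map_mx polyC e ->
  row_equiv (subst_row b u) (subst_row (b + c%:P * t) u).
Proof.
move=> c0 MM' M'M uM; rewrite /subst_row; set b' := b + _.
have C0 : c%:P != 0 by rewrite polyC_eq0.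
pose ev h := [eta map_mx (comp_poly h) : 'M[{poly A}]_r -> 'M[{poly A}]_r].
have cC h : c%:P \Po h = c%:P by rewrite comp_polyC.
have EMM' h : ev h M *m ev h M' = c%:P%:M.
  by rewrite /ev -map_mxM MM' map_scalar_mx /= cC.
have EM'M h : ev h M' *m ev h M = c%:P%:M.
  by rewrite /ev -map_mxM M'M map_scalar_mx /= cC.
have EuM h : map_mx (comp_poly h) u *m ev h M = map_mx polyC e.
  rewrite /ev -map_mxM uM -map_mx_comp; apply: eq_map_mx => a /=.
  exact: comp_polyC.
have [D MD] := comp_mx_shift M b (c%:P * t).
rewrite -/b' -!/(ev _ _) in MD.
have MD' : ev b M = ev b' M - (c%:P * t) *: D by rewrite MD addrK.
pose G := 1%:M - t *: (D *m ev b' M'); pose H := 1%:M + t *: (D *m ev b M').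
have GE : c%:P *: G = ev b M *m ev b' M'.
  by rewrite MD' mulmxBl EMM' scalerBr scalemx1 -scalemxAl scalerA.
have HE : c%:P *: H = ev b' M *m ev b M'.
  by rewrite MD mulmxDl EMM' scalerDr scalemx1 -scalemxAl scalerA.
(* For the inverses [c] is cancelled twice: [c ^ 2 G H] is [M(b) M'(b') M(b') M'(b)], whose inner
   product is [c]. *)
exists G, H; split.
- apply: (scalemxI C0); apply: (scalemxI C0) => /=.
  rewrite (scalemxAr c%:P G H) scalemxAl GE HE mulmxA -(mulmxA (ev b M)) EM'M.
  by rewrite mul_mx_scalar -scalemxAl EMM' scalemx1.
- apply: (scalemxI C0); apply: (scalemxI C0) => /=.
  rewrite (scalemxAr c%:P H G) scalemxAl GE HE mulmxA -(mulmxA (ev b' M)) EM'M.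
  by rewrite mul_mx_scalar -scalemxAl EMM' scalemx1.
(* [u M] is the constant row [e], so [u(b) M(b) = u(b') M(b')]; multiplying by [M'(b')] on the right
   gives [c u(b')]. *)
- apply: (scalemxI C0) => /=.
  by rewrite scalemxAr GE mulmxA EuM -(EuM b') -mulmxA EMM' mul_mx_scalar.
Qed.

Lemma suslin_equiv s (v : 'rV[{poly A}]_(1 + 1 + s)) (c : A) p q b t :
    c%:P = p * v 0 0 + q * v 0 (lift 0 0) ->
  row_equiv (subst_row b v) (subst_row (b + c%:P * t) v).
Proof.
move=> cE; have [->|c0] := eqVneq c 0.
  by rewrite mul0r addr0; apply: row_equiv_refl.
set x := v 0 0 in cE; set y := v 0 _ in cE.
pose u := lsubmx v; pose w := rsubmx v.
have uE : u = row_mx x%:M y%:M.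
  rewrite -[u]hsubmxK; congr row_mx; rewrite [LHS]mx11_scalar !mxE;
  by congr (v _ _)%:M; apply: val_inj.
have vE h : subst_row h v = row_mx (subst_row h u) (subst_row h w).
  by rewrite /subst_row -map_row_mx hsubmxK.
rewrite !vE; set b' := b + _.
(* [M] has determinant [c], [M'] is its adjugate, and [(x, y) M = (c, 0)]. *)
pose M := block_mx p%:M (- y)%:M q%:M x%:M : 'M_(1 + 1).
pose M' := block_mx x%:M y%:M (- q)%:M p%:M : 'M_(1 + 1).
pose m0 := col_mx p%:M q%:M : 'cV[{poly A}]_(1 + 1).
have um0 : u *m m0 = c%:P%:M.
  by rewrite uE mul_row_col -!scalar_mxM -raddfD /= [x * _]mulrC [y * _]mulrC cE.
(* First [w(b)] becomes [w(b')]: they differ by a multiple of [c = u(b) m0(b)], so adding multiples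
   of the entries of [u(b)] suffices. Then [suslin_pair] moves [u(b)] to [u(b')]. *)
apply: row_equiv_trans (row_equiv_row_mx _
  (suslin_pair (M := M) (M' := M') (e := row_mx c%:M 0) b t c0 _ _ _)).
- have [D wD] := comp_mx_shift w b (c%:P * t).
  have -> : subst_row b' w =
      subst_row b w + subst_row b u *m (map_mx (comp_poly b) m0 *m (t *: D)).
    rewrite mulmxA -map_mxM um0 map_scalar_mx /= comp_polyC mul_scalar_mx scalerA.
    exact: wD.
  exact: row_equiv_transvection.
- rewrite mulmx_block -!scalar_mxM -!raddfD /= (scalar_mx_block 1 1).
  by congr block_mx; apply/matrixP=> i j; rewrite !mxE !ord1 ?cE /=; ring.
- rewrite mulmx_block -!scalar_mxM -!raddfD /= (scalar_mx_block 1 1).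
  by congr block_mx; apply/matrixP=> i j; rewrite !mxE !ord1 ?cE /=; ring.
- rewrite uE mul_row_block -!scalar_mxM -!raddfD /= map_row_mx map_scalar_mx.
  rewrite map_mx0 /= cE.
  by congr row_mx; apply/matrixP=> i j; rewrite !mxE !ord1 /=; ring.
Qed.

Variables (k : closedFieldType) (iota : {rmorphism k -> A}).

Lemma row_equiv_comb s (w : 'rV[{poly A}]_(1 + s)) (a : 'I_(1 + s) -> {poly A}) :
  a 0 = 1 -> exists2 w', row_equiv w w' & w' 0 0 = \sum_i a i * w 0 i.
Proof.
move=> a0; pose T := \col_(i < s) a (lift 0 i).
exists (row_mx (lsubmx w + rsubmx w *m T) (rsubmx w)).
  rewrite -{1}[w]hsubmxK.
  exists (block_mx 1%:M 0 T 1%:M), (block_mx 1%:M 0 (- T) 1%:M); split.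
  - by rewrite mulmx_block !(mulmx0, mul0mx, mulmx1, mul1mx, addr0, add0r) subrr
      -scalar_mx_block.
  - by rewrite mulmx_block !(mulmx0, mul0mx, mulmx1, mul1mx, addr0, add0r) addNr
      -scalar_mx_block.
  - by rewrite mul_row_block !(mulmx0, mulmx1, add0r).
have -> (x : 'rV[{poly A}]_(1 + s)) : x 0 0 = x 0 (lshift s 0).
  by congr (x _ _); apply: val_inj.
rewrite row_mxEl !mxE big_ord_recl a0 mul1r; congr (_ + _).
  by congr (w _ _); apply: val_inj.
by apply: eq_bigr => i _; rewrite !mxE mulrC; congr (_ * w _ _); apply: val_inj.
Qed.

(** Asking this for all [b] and [t] makes these [c] an ideal: two shifts compose, and a factor of
    [c] is absorbed by [t]. *)
Definition shift_ideal r (v : 'rV[{poly A}]_r) (c : A) :=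
  forall b t, row_equiv (subst_row b v) (subst_row (b + c%:P * t) v).

Lemma shift_idealD r (v : 'rV[{poly A}]_r) c c' :
  shift_ideal v c -> shift_ideal v c' -> shift_ideal v (c + c').
Proof.
move=> vc vc' b t; apply: row_equiv_trans (vc b t) _.
by rewrite polyCD mulrDl addrA.
Qed.

Lemma shift_idealM r (v : 'rV[{poly A}]_r) a c :
  shift_ideal v c -> shift_ideal v (a * c).
Proof. by move=> vc b t; rewrite [a * c]mulrC polyCM -mulrA. Qed.

Lemma shift_ideal_equiv r (v w : 'rV[{poly A}]_r) c :
  row_equiv v w -> shift_ideal w c -> shift_ideal v c.
Proof.
move=> vw wc b t.
apply: row_equiv_trans (row_equiv_map (comp_poly b) vw) _.
apply: row_equiv_trans (wc b t) _.
exact/row_equiv_sym/row_equiv_map.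
Qed.

Lemma shift_ideal1 r (v : 'rV[{poly A}]_r) :
  shift_ideal v 1 -> row_equiv v (map_mx (fun p => p.[0]%:P) v).
Proof.
(* The shift goes from [b = 'X], where the row is [v] itself, to [b + t = 0]. *)
move=> /(_ 'X (- 'X)); rewrite mul1r subrr.
congr row_equiv; apply/matrixP=> i j; rewrite !mxE ?comp_polyXr //.
by rewrite -[0 in LHS]polyC0 comp_polyCr.
Qed.

(** [f] stands for evaluation at a point. At each root of the specialized first entry, unimodularity
    makes another entry nonzero; one combination of the other entries avoids all these roots, and
    elimination between it and the first entry gives [c]. *)
Lemma shift_ideal_nonzero s (v : 'rV[{poly A}]_(s.+2)) (d : A)
    (f : {rmorphism A -> k}) :
  cancel iota f -> unimodular v -> d *: v 0 0 \is monic ->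
  exists2 c, shift_ideal v c & f c != 0.
Proof.
move=> iotaK [u vu] mv.
pose x : 'rV[{poly A}]_1 := lsubmx (v : 'rV_(1 + s.+1)).
pose w : 'rV[{poly A}]_(1 + s) := rsubmx (v : 'rV_(1 + s.+1)).
have [rs rsE] := closed_field_poly_normal (map_poly f (d *: v 0 0)).
have rootP_mem z : root (map_poly f (d *: v 0 0)) z -> z \in rs.
  by rewrite rsE rootZ ?root_prod_XsubC // lead_coef_eq0 map_poly_eq0_id0
    ?monic_neq0 // (monicP mv) rmorph1 oner_neq0.
have fd : f d != 0.
  have := congr1 f (monicP mv); rewrite lead_coefE coefZ rmorphM rmorph1.
  by apply: contra_eq_neq => ->; rewrite mul0r eq_sym oner_neq0.
have wE i : w 0 i = v 0 (lift ord0 i).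
  by rewrite mxE; congr (v _ _); apply: val_inj.
have [|t ht] := @common_nonroot k s.+1 (fun i => map_poly f (w 0 i)) rs.
  move=> z zrs; apply: contrapT => /forallNP wz.
  have := congr1 (fun M : 'M_1 => (map_poly f (M 0 0)).[z]) vu.
  rewrite !mxE big_ord_recl rmorphD rmorph_sum /= rmorph1 hornerD horner_sum hornerC.
  rewrite big1 ?addr0 => [|i _].
    rewrite rmorphM hornerM; have /rootP : root (map_poly f (d *: v 0 0)) z.
      move: zrs; rewrite -root_prod_XsubC rsE => /rootP rz.
      by rewrite rootE hornerZ rz mulr0.
    rewrite map_polyZ hornerZ => /eqP; rewrite mulf_eq0 (negPf fd) => /eqP->.
    by rewrite mul0r => /eqP; rewrite eq_sym oner_eq0.
  rewrite rmorphM hornerM; have /negP/negPn/rootP := wz i.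
  by rewrite wE => ->; rewrite mul0r.
(* The coefficient of index 0 is 1, so the combination can replace the first entry of [w]; [iota]
   lifts [t] from [k] to [A]. *)
have [//|w' ww' w'E] := @row_equiv_comb s w (fun i => (iota t ^+ i)%:P).
have [|c [p [q [cE fc]]]] := @elimination A k f (d *: v 0 0) (w' 0 0) mv.
  move=> z /rootP_mem/ht; congr (~~ root _ _).
  rewrite w'E rmorph_sum; apply: eq_bigr => i _.
  by rewrite rmorphM /= map_polyC /= rmorphXn /= iotaK mul_polyC.
exists c => //.
have vv' : row_equiv v (row_mx x w' : 'rV_(1 + s.+1)).
  rewrite -(@hsubmxK _ 1 1 s.+1 v); exact: (@row_equiv_row_mx_r _ 1 s.+1 x w w').
apply: shift_ideal_equiv vv' _ => b t'.
apply: (@suslin_equiv s _ c (d%:P * p) q).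
rewrite cE -mul_polyC mulrA [p * _]mulrC; congr (_ * _ + _ * _).
  have -> : (0 : 'I_(1 + 1 + s)) = @lshift 1 s.+1 0 by apply: val_inj.
  apply: etrans (esym (@row_mxEl _ 1 1 s.+1 x w' 0 0)).
  by rewrite mxE; congr (v _ _); apply: val_inj.
have -> : (lift 0 0 : 'I_(1 + 1 + s)) = @rshift 1 s.+1 0 by apply: val_inj.
exact: (esym (@row_mxEr _ 1 1 s.+1 x w' 0 0)).
Qed.
End Suslin.

(** * Noether normalization *)

Section TopCoefficient.
Variable A : comNzRingType.
Implicit Types p q : {poly A}.

(** Allowing [c = 0] makes the notion multiplicative over any ring. *)
Definition top_coef d p (c : A) := (size p <= d.+1)%N /\ p`_d = c.

Lemma top_coef1 : top_coef 0 1 1.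
Proof. by split; rewrite ?size_poly1 ?coef1. Qed.

Lemma top_coefM d e p q a b :
  top_coef d p a -> top_coef e q b -> top_coef (d + e) (p * q) (a * b).
Proof.
move=> [sp <-] [sq <-]; split.
  apply: leq_trans (size_polyMleq _ _) _; rewrite -subn1 leq_subLR add1n.
  by have := leq_add sp sq; rewrite addSn addnS.
rewrite coefM (bigD1 (inord d)) //= inordK ?ltnS ?leq_addr // addKn.
rewrite big1 ?addr0 // => i; rewrite -val_eqE /= inordK ?ltnS ?leq_addr // => id.
case: (ltngtP i d) id => // [ltid|ltdi] _.
  rewrite [q`_ _]nth_default ?mulr0 //; apply: leq_trans sq _.
  by rewrite ltn_subRL ltn_add2r.
by rewrite nth_default ?mul0r //; apply: leq_trans sp _.
Qed.

Lemma top_coefX d p a n : top_coef d p a -> top_coef (d * n) (p ^+ n) (a ^+ n).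
Proof.
move=> h; elim: n => [|n IH]; first by rewrite muln0; apply: top_coef1.
by rewrite !exprS mulnS; apply: top_coefM.
Qed.

Lemma top_coef_prod (I : finType) (d : I -> nat) (p : I -> {poly A}) a :
  (forall i, top_coef (d i) (p i) (a i)) ->
  top_coef (\sum_i d i) (\prod_i p i) (\prod_i a i).
Proof.
move=> h; elim/big_ind3: _ => [|d1 p1 a1 d2 p2 a2|i _] //; first exact: top_coef1.
exact: top_coefM.
Qed.

End TopCoefficient.

Lemma mpoly_rmorph_eq (k S : comNzRingType) n (F G : {rmorphism {mpoly k[n]} -> S}) :
  (forall c, F c%:MP = G c%:MP) -> (forall i, F 'X_i = G 'X_i) -> F =1 G.
Proof.
move=> FGC FGX p; rewrite [p]mpolyE !rmorph_sum; apply: eq_bigr => m _.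
rewrite -mul_mpolyC !rmorphM FGC mpolyXE_id !rmorph_prod; congr (_ * _).
by apply: eq_bigr => i _; rewrite !rmorphXn FGX.
Qed.

Lemma mpoly0_const (k : comNzRingType) (p : {mpoly k[0]}) : p = (p@_0)%:MP.
Proof.
apply/mpolyP=> m; rewrite mcoeffC (_ : m = 0%MM) ?eqxx ?mulr1 //.
by apply/mnmP => -[].
Qed.

Section NoetherNormalization.
Variables (k : closedFieldType) (n : nat).
Implicit Types (p : {mpoly k[n.+1]}) (mu : 'I_n.+1 -> k).

(* Encodes X_j |-> X_j + mu_j x for j < n and X_n |-> mu_n x. *)
Definition last_var_poly mu : {mpoly k[n.+1]} -> {poly {mpoly k[n]}} :=
  mmap (polyC \o mpolyC n (R := k))
    (fun i => (oapp (fun j => 'X_j) 0 (unlift ord_max i))%:P + (mu i)%:MP%:P * 'X).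

HB.instance Definition _ mu := GRing.RMorphism.on (last_var_poly mu).

(** The substitution solved for the new variables: [x |-> X_n / mu_n] and
    [X_j |-> X_j - (mu_j / mu_n) X_n]. *)
Definition last_var_poly_inv mu : {poly {mpoly k[n]}} -> {mpoly k[n.+1]} :=
  horner_eval ((mu ord_max)^-1%:MP * 'X_ord_max) \o
  map_poly (mmap (mpolyC n.+1 (R := k))
    (fun j => 'X_(lift ord_max j)
              - (mu (lift ord_max j) / mu ord_max)%:MP * 'X_ord_max)).

HB.instance Definition _ mu := GRing.RMorphism.on (last_var_poly_inv mu).

Lemma last_var_polyC mu c : last_var_poly mu c%:MP = c%:MP%:P.
Proof. by rewrite /last_var_poly mmapC. Qed.

Lemma last_var_polyX mu i : last_var_poly mu 'X_i =
  (oapp (fun j => 'X_j) 0 (unlift ord_max i))%:P + (mu i)%:MP%:P * 'X.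
Proof. by rewrite /last_var_poly mmapX mmap1U. Qed.

Lemma last_var_polyK mu :
  mu ord_max != 0 -> cancel (last_var_poly mu) (last_var_poly_inv mu).
Proof.
move=> mu0; pose F := last_var_poly_inv mu \o last_var_poly mu.
apply: (@mpoly_rmorph_eq _ _ _ F idfun) => [c|i]; rewrite /F /=.
  by rewrite last_var_polyC /last_var_poly_inv /= map_polyC /= mmapC horner_evalE hornerC.
rewrite last_var_polyX rmorphD rmorphM /=.
rewrite /last_var_poly_inv /= map_polyX !map_polyC /= !horner_evalE.
rewrite hornerX !hornerC mmapC.
have [j ->|->] /= := unliftP ord_max i.
  rewrite mmapX mmap1U mulrA -mpolyCM.
  by rewrite -[RHS]subr0 -addrA addNr subr0 addr0.
by rewrite raddf0 add0r mulrA -mpolyCM divff // mul1r.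
Qed.

Definition last_var_point mu (a : 'I_n -> k) (b : k) (i : 'I_n.+1) :=
  oapp a 0 (unlift ord_max i) + mu i * b.

Lemma last_var_poly_eval mu a b p :
  p.@[last_var_point mu a b] = (map_poly (meval a) (last_var_poly mu p)).[b].
Proof.
pose F := [the {rmorphism _ -> _} of horner_eval b] \o
  ([the {rmorphism _ -> _} of map_poly (meval a)] \o last_var_poly mu).
apply: (@mpoly_rmorph_eq _ _ _ (meval (last_var_point mu a b)) F) => [c|i] /=.
  by rewrite last_var_polyC mevalC map_polyC /= mevalC horner_evalE hornerC.
rewrite last_var_polyX mevalXU rmorphD rmorphM /= map_polyX !map_polyC /= mevalC.
rewrite horner_evalE hornerD hornerM hornerX !hornerC; congr (_ + _).
by case: unlift => [j|] /=; rewrite ?mevalXU ?raddf0.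
Qed.

(** Each [X_i] becomes linear in the new variable with leading coefficient [mu_i], so a monomial of
    degree [e] has its value at [mu] as coefficient of the power [e]; only monomials of degree [d]
    reach the power [d]. *)
Lemma last_var_poly_top mu p d : (msize p <= d.+1)%N ->
  top_coef d (last_var_poly mu p) (pihomog mdeg d p).@[mu]%:MP.
Proof.
move=> sp.
have topX1 i : top_coef 1 (last_var_poly mu 'X_i) (mu i)%:MP.
  rewrite last_var_polyX; split.
    by rewrite addrC size_MXaddC; case: ifP => // _; rewrite ltnS size_polyC_leq1.
  by rewrite coefD mul_polyC coefZ coefX coefC add0r mulr1.
have topX m : top_coef (mdeg m) (last_var_poly mu 'X_[m]) (\prod_i mu i ^+ m i)%:MP.
  rewrite mpolyXE_id !rmorph_prod mdegE; apply: top_coef_prod => i.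
  by rewrite !rmorphXn; have := top_coefX (m i) (topX1 i); rewrite mul1n.
split.
  rewrite [p]mpolyE rmorph_sum big_seq /=.
  apply: leq_trans (size_sum _ _ _) _; apply/bigmax_leqP_seq => m mp _.
  rewrite -mul_mpolyC rmorphM /= last_var_polyC mul_polyC.
  apply: leq_trans (size_scale_leq _ _) _; have [s _] := topX m.
  exact: leq_trans s (leq_trans (msize_mdeg_lt mp) sp).
have -> : (pihomog mdeg d p).@[mu] =
    \sum_(m <- msupp p | mdeg m == d) p@_m * \prod_i mu i ^+ m i.
  by rewrite pihomogE (raddf_sum (meval mu)); apply: eq_bigr => m _;
    rewrite /= mevalZ mevalX.
rewrite (raddf_sum (@mpolyC n k)) [in LHS](mpolyE p) (rmorph_sum (last_var_poly mu)).
rewrite coef_sum [RHS]big_mkcond big_seq [RHS]big_seq; apply: eq_bigr => m mp.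
rewrite /= -mul_mpolyC rmorphM /= last_var_polyC coefCM.
have [s t] := topX m; case: eqP => [<-|/eqP md].
  by rewrite t mpolyCM.
rewrite nth_default ?mulr0 //; apply: leq_trans s _.
by rewrite ltn_neqAle md -ltnS (leq_trans (msize_mdeg_lt mp) sp).
Qed.

End NoetherNormalization.

Lemma mpoly_nonroot (k : closedFieldType) n (p : {mpoly k[n]}) :
  p != 0 -> exists a, p.@[a] != 0.
Proof.
elim: n p => [|n IH] p p0.
  exists (fun=> 0); apply: contraNneq p0.
  by rewrite [p]mpoly0_const mevalC => ->; rewrite mpolyC0.
(* With [mu] the last unit vector, the substitution merely singles out the last variable. *)
pose mu i := (i == @ord_max n)%:R : k.
have mu0 : mu ord_max != 0 by rewrite /mu eqxx oner_neq0.
have q0 : last_var_poly mu p != 0.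
  by rewrite -(inj_eq (can_inj (last_var_polyK mu0))) rmorph0 in p0 *.
have /IH[a ha] : lead_coef (last_var_poly mu p) != 0 by rewrite lead_coef_eq0.
have /closed_nonrootP[b hb] : map_poly (meval a) (last_var_poly mu p) != 0.
  by apply: contraNneq ha => h; rewrite lead_coefE -coef_map h coef0.
by exists (last_var_point mu a b); rewrite last_var_poly_eval.
Qed.

(** After the substitution the top coefficient is the value at [mu] of the form of highest degree of
    [p], which is nonzero for a suitable [mu]. *)
Lemma noether_normalization (k : closedFieldType) n (p : {mpoly k[n.+1]}) :
    p != 0 ->
  exists (psi : {rmorphism {mpoly k[n.+1]} -> {poly {mpoly k[n]}}})
    (phi : {rmorphism {poly {mpoly k[n]}} -> {mpoly k[n.+1]}})
    (pt : ('I_n -> k) -> k -> 'I_n.+1 -> k) (d : k),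
  [/\ cancel psi phi, forall c, psi c%:MP = c%:MP%:P,
      forall a b f, f.@[pt a b] = (map_poly (meval a) (psi f)).[b]
    & d%:MP *: psi p \is monic].
Proof.
move=> p0; pose d := mdeg (mlead p); pose q := pihomog mdeg d p.
have qE l : mdeg l = d -> q@_l = p@_l.
  move=> dl; rewrite [in RHS](mpolyE p) /q pihomogE !(raddf_sum (mcoeff _)) big_mkcond /=.
  apply: eq_bigr => m _; rewrite !mcoeffZ mcoeffX.
  by case: (eqVneq m l) => [->|_]; rewrite ?dl ?eqxx ?mulr0 ?if_same.
have q0 : q != 0.
  apply: contraNneq p0 => q0; rewrite -mleadc_eq0 -qE //.
  by rewrite q0 mcoeff0.
(* The extra factor makes [mu ord_max] nonzero as well, so that the change of variables can be
   undone. *)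
have /mpoly_nonroot[mu] : q * 'X_ord_max != 0.
  by rewrite mulf_neq0 // -msize_poly_eq0 msizeX.
rewrite mevalM mevalXU mulf_eq0 negb_or => /andP[qmu mu0].
exists (last_var_poly mu), (last_var_poly_inv mu), (last_var_point mu), q.@[mu]^-1.
split; [exact: last_var_polyK | exact: last_var_polyC | exact: last_var_poly_eval |].
have [] : top_coef d (last_var_poly mu p) q.@[mu]%:MP.
  by apply: last_var_poly_top; rewrite mlead_deg.
move=> sz top; set f := last_var_poly mu p in sz top *.
have lf : lead_coef f = q.@[mu]%:MP.
  have szd : (d < size f)%N.
    rewrite ltnNge; apply: contraNN qmu => /(nth_default 0) fd0.
    by rewrite -(mpolyC_eq0 n) -top fd0.
  by rewrite lead_coefE -top (_ : size f = d.+1) //; apply/eqP; rewrite eqn_leq sz.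
by rewrite monicE lead_coefZ lf -mpolyCM mulVf.
Qed.

(** * The weak Nullstellensatz and the Quillen-Suslin theorem *)

(** Induction by contracting [I] to the polynomials free of one variable. Over a point [a], a monic
    [p] in [I] has finitely many roots; one element of [I] avoids them all, and eliminating the
    variable between it and [p] gives an element of the contraction that is nonzero at [a]. *)
Lemma weak_nullstellensatz (k : closedFieldType) n (I : {mpoly k[n]} -> Prop) :
    (forall p q, I p -> I q -> I (p + q)) -> (forall a p, I p -> I (a * p)) ->
    (forall x, exists2 p, I p & p.@[x] != 0) ->
  I 1.
Proof.
elim: n I => [|n IH] I ID IM nz.
  have [p Ip] := nz (fun=> 0); rewrite (mpoly0_const p) mevalC => p0.
  have := IM (p@_0)^-1%:MP _ Ip.
  by rewrite [p in _ * p]mpoly0_const -mpolyCM mulVf.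
have [p Ip p0] := nz (fun=> 0).
have /noether_normalization[psi [phi [pt [d [psiK psiC psi_eval mp]]]]] : p != 0.
  by apply: contraNneq p0 => ->; rewrite meval0.
rewrite -(rmorph1 phi) -polyC1.
apply: (IH (fun c => I (phi c%:P))) => [c c' Ic Ic'|c c' Ic'|a].
- by rewrite polyCD rmorphD; apply: ID.
- by rewrite polyCM rmorphM; apply: IM.
have I0 : I 0 by rewrite -(mul0r p); apply: IM.
have /choice[Q IQ] : forall x, exists q, I q /\ (map_poly (meval a) (psi q)).[x] != 0.
  move=> x; have [q Iq qx] := nz (pt a x).
  by exists q; rewrite -psi_eval.
have [rs rsE] := closed_field_poly_normal (map_poly (meval a) (d%:MP *: psi p)).
pose w i := map_poly (meval a) (psi (Q rs`_i)).
have [|t ht] := @common_nonroot k (size rs) (fun i => w i) rs.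
  move=> x xrs; exists (Ordinal (etrans (index_mem x rs) xrs)).
  by rewrite /w /= nth_index //; have [] := IQ x.
pose q := \sum_(i < size rs) (t ^+ i)%:MP * Q rs`_i.
have Iq : I q.
  by rewrite /q; elim/big_ind: _ => // i _; apply: IM; have [] := IQ rs`_i.
have [|c [u [v [cE ca]]]] := @elimination _ k (meval a) _ (psi q) mp.
  move=> x; rewrite rsE => hx.
  rewrite (_ : map_poly _ (psi q) = \sum_(i < size rs) t ^+ i *: w i).
    apply: ht; move: hx; rewrite rootZ ?root_prod_XsubC // lead_coef_eq0.
    by rewrite map_poly_eq0_id0 ?monic_neq0 // (monicP mp) rmorph1 oner_neq0.
  rewrite /q !rmorph_sum; apply: eq_bigr => i _.
  by rewrite !rmorphM /= psiC map_polyC /= mevalC mul_polyC.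
exists c => //; rewrite cE rmorphD !rmorphM.
apply: ID; last by apply: IM; rewrite psiK.
by rewrite -mul_polyC rmorphM mulrA; apply: IM; rewrite psiK.
Qed.

Lemma unimodular_nonzero_pivot (A : idomainType) r (v : 'rV[A]_r.+1) :
  unimodular v -> exists2 w, row_equiv v w & w 0 0 != 0.
Proof.
move=> [u vu]; have /existsP[i vi] : [exists i, v 0 i != 0].
  apply: contraT; rewrite negb_exists => /forallP v0.
  have := congr1 (fun M : 'M_1 => M 0 0) vu.
  rewrite !mxE big1 => [/eqP|i _]; first by rewrite eq_sym oner_eq0.
  by have /negPn/eqP-> := v0 i; rewrite mul0r.
by exists (xcol 0 i v); [apply: row_equiv_xcol | rewrite mxE tpermL].
Qed.

Theorem quillen_suslin (k : closedFieldType) n r (v : 'rV[{mpoly k[n]}]_r.+1) :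
  unimodular v -> row_equiv v (delta_mx 0 0).
Proof.
elim: n r v => [|n IH] r v /[dup] uv0 /unimodular_nonzero_pivot[w vw w0];
    apply: (row_equiv_trans vw); have {vw uv0} uw := unimodular_equiv vw uv0.
  apply: (@row_equiv_unit _ r w ((w 0 0)@_0)^-1%:MP).
  rewrite [X in _ * X]mpoly0_const -mpolyCM mulVf //.
  by apply: contraNneq w0 => h; rewrite [w 0 0]mpoly0_const h mpolyC0.
(* A unimodular row of length 1 is a unit; longer rows have the two entries that the shift argument
   uses. *)
case: r v w w0 uw => [|s] _ w w0 uw.
  have [u wu] := uw; apply: (@row_equiv_unit _ 0 w (u 0 0)).
  have := congr1 (fun M : 'M_1 => M 0 0) wu.
  by rewrite !mxE big_ord1 mulrC.
have [psi [phi [_ [d [psiK _ _ mw]]]]] := noether_normalization w0.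
pose v := map_mx psi w.
have uv : unimodular v by apply: unimodular_map.
have v1 : shift_ideal v 1.
  apply: weak_nullstellensatz => [c c'|c c'|a].
  - exact: shift_idealD.
  - exact: shift_idealM.
  have evK : cancel (mpolyC n (R := k)) (meval a) by move=> c; rewrite mevalC.
  have mv : d%:MP *: v 0 0 \is monic by rewrite mxE.
  exact: (shift_ideal_nonzero evK uv mv).
have : row_equiv v (delta_mx 0 0).
  apply: row_equiv_trans (shift_ideal1 v1) _.
  (* The row at 0 has its entries in [n] variables and stays unimodular, so induction applies; [phi]
     later brings the equivalence back. *)
  have /IH/(row_equiv_map polyC) : unimodular (map_mx (horner_eval 0) v).
    exact: unimodular_map.
  by rewrite map_delta_mx -map_mx_comp.
move=> /(row_equiv_map phi); rewrite map_delta_mx -map_mx_comp.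
rewrite [map_mx (phi \o psi) w](_ : _ = w) //.
by apply/matrixP=> i j; rewrite mxE /= psiK.
Qed.

(** * Free submodules of A^n *)

Section FreeSubmodules.
Variable A : idomainType.

Lemma frac_numden (x : {fraction A}) :
  exists a b : A, b != 0 /\ x * tofrac b = tofrac a.
Proof.
elim/quotW: x => x; exists \n_x, \d_x; split; first exact: denom_ratioP.
unlock tofrac; rewrite -[LHS]FracField.pi_mul; apply/eqmodP.
rewrite /= FracField.equivfE /FracField.mulf !numden_Ratio
  ?mulf_neq0 ?oner_eq0 ?denom_ratioP //.
by rewrite !mulr1 mulrC.
Qed.

(** Over the fraction field this is a rank count; the kernel vector found there is then cleared of
    denominators. *)
Lemma left_kernel_nonzero m n (M : 'M[A]_(m, n)) :
  (n < m)%N -> exists2 c : 'rV_m, c != 0 & c *m M = 0.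
Proof.
move=> ltnm; pose K := kermx (map_mx (@tofrac A) M).
have /rowV0Pn[v /sub_kermxP vM v0] : K != 0.
  by rewrite -mxrank_eq0 mxrank_ker subn_eq0 -ltnNge (leq_ltn_trans (rank_leq_col _)).
have /fin_all_exists[a /fin_all_exists[b ab]] : forall j, exists a b : A,
  b != 0 /\ v 0 j * tofrac b = tofrac a by move=> j; apply: frac_numden.
pose d := \prod_j b j; have d0 : d != 0 by apply/prodf_neq0 => j _; case: (ab j).
(* This is [d v] written without fractions, as [v_j = a_j / b_j]. *)
pose c := \row_j (a j * \prod_(i | i != j) b i).
have cE : map_mx (@tofrac A) c = tofrac d *: v.
  apply/rowP=> j; have [_ abj] := ab j.
  by rewrite !mxE /d [in RHS](bigD1 j) //= !tofracM -abj; ring.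
exists c.
  apply: contraNneq v0 => c0; move: cE; rewrite c0 map_mx0 => /esym/eqP.
  by rewrite scaler_eq0 tofrac_eq0 (negPf d0).
have : map_mx (@tofrac A) (c *m M) = 0 by rewrite map_mxM cE -scalemxAl vM scaler0.
move=> /matrixP h; apply/matrixP=> i j; have := h i j; rewrite !mxE => /eqP.
by rewrite tofrac_eq0 => /eqP.
Qed.

(** A finite basis is stored as the rows of a matrix, so that a change of basis is a multiplication
    on the left. *)
Definition row_basis r n (B : 'M[A]_(r, n)) (D : set 'rV[A]_n) :=
  (forall c : 'rV_r, c *m B = 0 -> c = 0) /\
  (forall d, D d <-> exists c, d = c *m B).

Lemma sum_seq_mulmx n (s : seq 'rV[A]_n) (a : 'rV[A]_n -> A) :
  \sum_(u <- s) a u *: u =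
  (\row_(i < size s) a s`_i) *m (\matrix_(i < size s) s`_i).
Proof.
rewrite (big_nth 0) big_mkord mulmx_sum_row; apply: eq_bigr => i _.
by rewrite mxE rowK.
Qed.

Lemma uniq_seq_row n (s : seq 'rV[A]_n) (c : 'rV[A]_(size s)) :
  uniq s -> exists a, c = \row_(i < size s) a s`_i.
Proof.
move=> us; exists (fun u => if insub (index u s) is Some i then c 0 i else 0).
apply/rowP=> i; rewrite !mxE index_uniq // insubT //= => p.
by congr (c _ _); apply: val_inj.
Qed.

Lemma independent_seq_mulmx n (B : set 'rV[A]_n) (s : seq 'rV[A]_n) :
    lin_independent B -> uniq s -> (forall u, u \in s -> B u) ->
  forall c : 'rV_(size s), c *m (\matrix_(i < size s) s`_i) = 0 -> c = 0.
Proof.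
move=> indB us sB c; have [a ->] := uniq_seq_row c us.
rewrite -sum_seq_mulmx => /(indB s a us sB) a0.
by apply/rowP=> i; rewrite !mxE a0 // mem_nth.
Qed.

(** Any [n + 1] vectors of [A^n] satisfy a linear relation, hence every basis is finite. *)
Lemma free_row_basis n (D : set 'rV[A]_n) :
  is_free_module D -> exists r (B : 'M[A]_(r, n)), row_basis B D.
Proof.
move=> [B [indB ->]].
have [s [us sB Bs]] : exists s : seq 'rV[A]_n,
    [/\ uniq s, forall u, u \in s -> B u & forall u, B u -> u \in s].
  apply: contrapT => nos.
  (* A set that no list exhausts contains [n + 1] distinct vectors, picked one at a time. *)
  have [s [us sB ss]] : exists s : seq 'rV[A]_n,
      [/\ uniq s, forall u, u \in s -> B u & size s = n.+1].
    elim: n.+1 => [|m [s [us sB ss]]]; first by exists [::].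
    have [u [Bu us']] : exists u, B u /\ u \notin s.
      apply: contrapT => nou; apply: nos; exists s; split=> // u Bu.
      by apply: contraT => us'; case: nou; exists u.
    exists (u :: s); split=> [/=|v|/=]; rewrite ?us' ?ss // inE.
    by case/orP=> [/eqP->|/sB].
  have [|c c0 cM] := @left_kernel_nonzero (size s) n (\matrix_(i < size s) s`_i).
    by rewrite ss.
  by rewrite (independent_seq_mulmx indB us sB cM) eqxx in c0.
exists (size s), (\matrix_(i < size s) s`_i); split.
  exact: independent_seq_mulmx indB us sB.
move=> d; split=> [[t [a [tB ->]]]|[c ->]]; last first.
  by have [a ->] := uniq_seq_row c us; exists s, a; rewrite sum_seq_mulmx.
rewrite big_seq; elim/big_ind: _ => [|_ _ [c ->] [c' ->]|u ut].
- by exists 0; rewrite mul0mx.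
- by exists (c + c'); rewrite mulmxDl.
have us' := Bs u (tB u ut); pose i := Ordinal (etrans (index_mem u s) us').
exists (a u *: delta_mx 0 i).
by rewrite -scalemxAl -rowE rowK /= nth_index.
Qed.

Lemma row_basis_free n r (B : 'M[A]_(r, n)) (D : set 'rV[A]_n) :
  row_basis B D -> is_free_module D.
Proof.
move=> [indB DB]; pose s := [seq row i B | i <- enum 'I_r].
have injB : injective (fun i => row i B).
  move=> i j /eqP; rewrite -subr_eq0 !rowE -mulmxBl => /eqP/indB/eqP.
  rewrite subr_eq0 => /eqP/matrixP/(_ 0 i); rewrite !mxE !eqxx /=.
  by case: eqP => // _ /eqP; rewrite oner_eq0.
have us : uniq s by rewrite map_inj_uniq ?enum_uniq.
exists [set u | u \in s]; split.
  (* [t] lists some rows in any order; the sum is reindexed along [s], with coefficient 0 at the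
     rows outside [t]. *)
  move=> t a ut ts; rewrite (perm_big [seq u <- s | u \in t]); last first.
    apply: uniq_perm => //; first exact: filter_uniq.
    by move=> u; rewrite mem_filter; case: (boolP (u \in t)) => // /ts ->.
  rewrite big_filter big_map big_enum_cond /= big_mkcond /=.
  pose c := \row_i (if row i B \in t then a (row i B) else 0).
  have -> : \sum_i (if row i B \in t then a (row i B) *: row i B else 0) = c *m B.
    rewrite mulmx_sum_row; apply: eq_bigr => i _.
    by rewrite mxE; case: ifP; rewrite ?scale0r.
  move=> /indB/rowP c0 u u_t; have /mapP[i _ uE] := ts u u_t.
  by have := c0 i; rewrite !mxE -uE u_t.
apply/seteqP; split=> d.
  (* A span wants one coefficient per vector, not per index; this sum has a single term because the
     rows are distinct. *)
  move=> /DB[c ->]; exists s, (fun u => \sum_(i | row i B == u) c 0 i); split=> //.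
  rewrite big_map big_enum mulmx_sum_row; apply: eq_bigr => i _; congr (_ *: _).
  by rewrite (big_pred1 i) // => j; rewrite /= (inj_eq injB).
move=> [t [a [ts ->]]]; apply/DB.
rewrite big_seq; elim/big_ind: _ => [|_ _ [c ->] [c' ->]|u /ts/mapP[i _ uE]].
- by exists 0; rewrite mul0mx.
- by exists (c + c'); rewrite mulmxDl.
by exists (a u *: delta_mx 0 i); rewrite -scalemxAl -rowE uE.
Qed.

(** * Splitting off a vector [theta] with [theta phi = g] *)

Section Split.
Variables (n : nat) (g : A) (phi : 'cV[A]_n) (theta : 'rV[A]_n).
Hypotheses (g0 : g != 0) (theta_phi : theta *m phi = g%:M).

(** For [phi] the column of partial derivatives of [g], these are Der(X) and Der_0(X). *)
Let D : set 'rV[A]_n := [set d | exists q, (d *m phi) 0 0 = q * g].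
Let D0 : set 'rV[A]_n := [set d | (d *m phi) 0 0 = 0].

(** If [d phi = q g], then [d - q theta] lies in [D0]; a linear relation multiplied by [phi] forces
    the coefficient of [theta] to be 0. *)
Lemma kernel_basis_extend r (B : 'M[A]_(r, n)) :
  row_basis B D0 -> row_basis (col_mx B theta) D.
Proof.
move=> [indB D0B].
have Bphi (c : 'rV_r) : c *m B *m phi = 0.
  apply/matrixP=> i j; rewrite !ord1 [RHS]mxE.
  by have : D0 (c *m B) by apply/D0B; exists c.
split=> [c|d].
  rewrite -[c]hsubmxK mul_row_col => cB.
  have := congr1 (mulmx^~ phi) cB.
  rewrite mulmxDl Bphi add0r -mulmxA theta_phi mul0mx mul_mx_scalar => gr.
  have r0 : rsubmx c = 0 by apply: (scalemxI g0); rewrite /= gr scaler0.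
  by move: cB; rewrite r0 mul0mx addr0 => /indB ->; rewrite row_mx0.
split=> [[q dq]|[c ->]].
  have /D0B[c dE] : D0 (d - q *: theta).
    rewrite /D0 /= mulmxBl -scalemxAl theta_phi !mxE -[X in X - _]mulr1.
    by rewrite mulr1n; move: dq; rewrite mxE => ->; rewrite mulr1 subrr.
  by exists (row_mx c q%:M); rewrite mul_row_col -dE mul_scalar_mx subrK.
rewrite -[c]hsubmxK mul_row_col; exists (rsubmx c 0 0).
rewrite mulmxDl Bphi add0r -mulmxA theta_phi mul_mx_scalar [LHS]mxE mulrC.
by rewrite mxE.
Qed.

Lemma kernel_basis_exists r (B : 'M[A]_(r, n)) :
    (forall s (v : 'rV[A]_s.+1), unimodular v -> row_equiv v (delta_mx 0 0)) ->
    row_basis B D ->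
  exists s (B0 : 'M[A]_(s, n)), row_basis B0 D0.
Proof.
move=> qs [indB DB].
have /fin_all_exists[q qE] : forall i, exists q, (row i B *m phi) 0 0 = q * g.
  move=> i; have : D (row i B) by apply/DB; exists (delta_mx 0 i); rewrite rowE.
  by [].
pose psi := \col_i q i.
have Bphi : B *m phi = g *: psi.
  by apply/colP=> i; rewrite [RHS]mxE [psi i 0]mxE mulrC -qE -row_mul [RHS]mxE.
have [c cE] : exists c, theta = c *m B.
  by apply/DB; exists 1; rewrite theta_phi mxE mul1r.
(* Multiplying [theta = c B] by [phi] gives [g = g (c psi)], and [g] cancels. *)
have cpsi : c *m psi = 1%:M.
  apply: (scalemxI g0) => /=.
  by rewrite scalemxAr -Bphi mulmxA -cE theta_phi scalemx1.
have upsi : unimodular psi^T by exists c^T; rewrite -trmx_mul cpsi trmx1.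
case: r B indB DB q qE psi Bphi c cE cpsi upsi
  => [|s] B indB DB q qE psi Bphi c cE cpsi upsi.
  have := congr1 (fun M : 'M_1 => M 0 0) cpsi; rewrite !mxE big_ord0 => /eqP.
  by rewrite eq_sym oner_eq0.
have [M [N [MN NM psiM]]] := qs _ _ upsi.
(* In this basis [B' phi] is the column [(g, 0, ..., 0)]: all rows but the first lie in [D0], and
   [y B'] lies there only if [y_0 g = 0]. *)
pose B' := M^T *m B : 'M_(1 + s, n).
have B'phi : B' *m phi = g *: delta_mx 0 0.
  by rewrite -mulmxA Bphi -scalemxAr -[psi]trmxK -trmx_mul psiM trmx_delta.
have indB' (x : 'rV_(1 + s)) : x *m B' = 0 -> x = 0.
  rewrite mulmxA => /indB xM.
  by rewrite -[x]mulmx1 -[X in _ *m X]trmx1 -NM trmx_mul mulmxA xM mul0mx.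
exists s, (dsubmx B'); split=> [x xB|d].
  have := indB' (row_mx 0 x); rewrite -[B']vsubmxK mul_row_col mul0mx add0r => /(_ xB).
  by rewrite -[0 in RHS]row_mx0 => /eq_row_mx[].
split=> [d0|[x ->]].
  have [x xE] : exists x, d = x *m B by apply/DB; exists 0; rewrite mul0r.
  pose y : 'rV_(1 + s) := x *m N^T.
  have dE : d = y *m B' by rewrite mulmxA -[x *m _ *m _]mulmxA -trmx_mul MN trmx1 mulmx1.
  have y0 : y 0 0 = 0.
    apply: (mulfI g0); rewrite mulr0 -[RHS]d0 dE -mulmxA B'phi -scalemxAr [RHS]mxE.
    by congr (_ * _); rewrite -colE [RHS]mxE.
  exists (rsubmx y); rewrite dE -{1}[y]hsubmxK -{1}[B']vsubmxK mul_row_col.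
  rewrite (_ : lsubmx y = 0) ?mul0mx ?add0r //.
  apply/matrixP=> i j; rewrite !ord1 [RHS]mxE -y0 [LHS]mxE.
  by congr (y _ _); apply: val_inj.
rewrite /D0 /= -mulmxA (_ : dsubmx B' *m phi = 0) ?mulmx0 ?mxE //.
rewrite -[_ *m _](@col_mxKd _ 1 _ _ (usubmx B' *m phi)) -mul_col_mx vsubmxK B'phi.
by apply/matrixP=> i j; rewrite !mxE mulr0.
Qed.

End Split.
End FreeSubmodules.

(** * Derivations of a hypersurface *)

Lemma mderiv_mulX (k : comNzRingType) n (p : {mpoly k[n]}) j :
  'X_j * p^`M(j) = \sum_(m <- msupp p) (p@_m * (m j)%:R) *: 'X_[m].
Proof.
rewrite [in LHS](mpolyE p) linear_sum mulr_sumr; apply: eq_bigr => m _ /=.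
rewrite linearZ /= mderivX -!scalerAr scalerA.
(* For [m j = 0] the subtraction of exponents is truncated, but the coefficient vanishes. *)
have [->|mj] := eqVneq (m j) 0%N; first by rewrite !mulr0 !scale0r.
congr (_ *: _); rewrite -mpolyXD addmC submK //.
by apply/mnm_lepP => i; rewrite mnm1E; case: eqVneq => // <-; rewrite lt0n.
Qed.

(** By [mderiv_mulX] the left side multiplies each monomial by its weighted degree, which is [N] on
    the support of [g]. *)
Lemma euler_formula (k : numFieldType) n (w : 'I_n -> int) (N : int)
    (g : {mpoly k[n]}) :
    (forall m, g@_m != 0 -> \sum_(j < n) w j * (m j)%:Z = N) ->
  \sum_(j < n) (w j)%:~R *: ('X_j * g^`M(j)) = N%:~R *: g.
Proof.
move=> wg; under eq_bigr do rewrite mderiv_mulX scaler_sumr.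
rewrite exchange_big [in RHS](mpolyE g) scaler_sumr /= big_seq [RHS]big_seq.
apply: eq_bigr => m; rewrite mcoeff_msupp => /wg <-.
rewrite rmorph_sum scalerA mulr_suml scaler_suml; apply: eq_bigr => j _.
by rewrite scalerA rmorphM /= mulrA mulrAC.
Qed.

Section Derivations.
Variables (R : realType) (n : nat) (g : {mpoly R[i][n]}).

Lemma nonsingular_submersion : (forall x, ~ singular_point g x) <-> submersion g.
Proof.
split=> [ns x c|sub x sx]; last first.
  have [v] := sub x 1; rewrite /differential big1 => [/eqP|j _].
    by rewrite eq_sym oner_eq0.
  by rewrite sx mul0r.
have [j gj] : exists j, (g^`M(j)).@[x] != 0.
  apply: contrapT => h; apply: (ns x) => j; apply/eqP.
  by apply: contraT => gj; case: h; exists j.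
exists (fun i => if i == j then c / (g^`M(j)).@[x] else 0).
rewrite /differential (bigD1 j) //= eqxx big1 ?addr0 => [|i /negPf->].
  by rewrite mulrC divfK.
by rewrite mulr0.
Qed.

Lemma submersion_jacobian :
  submersion g <-> jacobian_ideal g = [set: {mpoly R[i][n]}].
Proof.
rewrite -nonsingular_submersion; split=> [ns|JT x sx]; last first.
  have : jacobian_ideal g 1 by rewrite JT.
  move=> [a /(congr1 (meval x))]; rewrite rmorph1 rmorph_sum big1 => [/eqP|j _].
    by rewrite oner_eq0.
  by rewrite rmorphM /= sx mulr0.
apply/seteqP; split=> // p _; rewrite -[p]mulr1.
have JM q h : jacobian_ideal g h -> jacobian_ideal g (q * h).
  move=> [a ->]; exists (fun j => q * a j); rewrite mulr_sumr.
  by apply: eq_bigr => j _; rewrite mulrA.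
(* The weak Nullstellensatz puts 1 into the Jacobian ideal, since at each point some partial
   derivative is nonzero. *)
apply: (JM); apply: (@weak_nullstellensatz R[i] n (jacobian_ideal g)) => //.
  move=> _ _ [a ->] [b ->]; exists (fun j => a j + b j).
  by rewrite -big_split; apply: eq_bigr => j _; rewrite mulrDl.
move=> x; apply: contrapT => h; apply: (ns x) => j; apply/eqP.
apply: contraT => gj; case: h; exists (g^`M(j)) => //.
exists (fun i => (i == j)%:R); rewrite (bigD1 j) //= eqxx mul1r big1 ?addr0 //.
by move=> i /negPf->; rewrite mul0r.
Qed.

Let grad : 'cV[{mpoly R[i][n]}]_n := \col_j g^`M(j).

Lemma der_applyE (d : der R n) : der_apply d g = (d *m grad) 0 0.
Proof. by rewrite !mxE; apply: eq_bigr => j _; rewrite mxE. Qed.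

Lemma A_free_equiv_A0_free (theta : der R n) :
  g != 0 -> der_apply theta g = g -> A_free g <-> A0_free g.
Proof.
move=> g0 tg.
have t_grad : theta *m grad = g%:M.
  by rewrite [LHS]mx11_scalar -der_applyE tg.
have DE : Der g = [set d | exists q, (d *m grad) 0 0 = q * g].
  by apply/seteqP; split=> d /=; rewrite /Der /principal_ideal /= der_applyE.
have D0E : Der0 g = [set d | (d *m grad) 0 0 = 0].
  by apply/seteqP; split=> d /=; rewrite /Der0 /= der_applyE.
rewrite /A_free /A0_free DE D0E; split.
  move=> /free_row_basis[r [B BD]].
  have [s [B0 B0D]] := kernel_basis_exists g0 t_grad (@quillen_suslin R[i] n) BD.
  exact: row_basis_free B0D.
move=> /free_row_basis[r [B BD]].
exact: row_basis_free (kernel_basis_extend g0 t_grad BD).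
Qed.

End Derivations.

Theorem corollary3p4 (R : realType) (n : nat) (g : {mpoly R[i][n]})
    (g_nonconstant : nonconstant g) (g_reduced : reduced g) :
  [/\ (forall x, ~ singular_point g x) <-> submersion g,
      submersion g <-> jacobian_ideal g = [set: {mpoly R[i][n]}]
    & submersion g \/
      (exists (w : 'I_n -> int) (N : int),
         [/\ forall j, w j != 0, N != 0 & weighted_homogeneous w N g]) ->
      (A_free g <-> A0_free g)].
Proof.
split; [exact: nonsingular_submersion | exact: submersion_jacobian |].
have g0 : g != 0 by apply/eqP => g0; case: (g_nonconstant 0); rewrite mpolyC0.
case=> [/submersion_jacobian JT|[w [N [_ N0 wg]]]].
  (* The coefficients that express [g] by its partial derivatives are those of a derivation fixing
     [g]. *)
  have [a aE] : jacobian_ideal g g by rewrite JT.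
  apply: (@A_free_equiv_A0_free _ _ _ (\row_j a j)) => //.
  by rewrite [RHS]aE; apply: eq_bigr => j _; rewrite mxE.
apply: (@A_free_equiv_A0_free _ _ _ (\row_j (((w j)%:~R / N%:~R) *: 'X_j))) => //.
have NR : N%:~R != 0 :> R[i] by rewrite intr_eq0.
have -> : der_apply (\row_j (((w j)%:~R / N%:~R) *: 'X_j)) g =
    N%:~R^-1 *: \sum_(j < n) (w j)%:~R *: ('X_j * g^`M(j)).
  rewrite scaler_sumr; apply: eq_bigr => j _.
  by rewrite mxE scalerA -scalerAl mulrC.
by rewrite (euler_formula wg) scalerA mulVf // scale1r.
Qed.
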